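(* Every finite simplicial complex $K$ has a core, and any two cores of $K$ are isomorphic. Moreover, two finite simplicial complexes have the same strong homotopy type if and only if their cores are isomorphic.
   Context: All simplicial complexes are finite (simplices are nonempty finite sets of vertices). For a vertex $v$ of a complex $K$, the link $\mathrm{lk}_K(v)$ is the subcomplex of simplices $\tau\in K$ with $v\notin\tau$ and $\tau\cup\{v\}\in K$, and $K\smallsetminus v$ is the full subcomplex of $K$ spanned by the vertices different from $v$. A simplicial cone is a complex $aM$, the join of a (possibly empty) complex $M$ and a vertex $a$ not in $M$; its simplices are $\{a\}$, the simplices $\tau$ of $M$, and the sets $\{a\}\cup\tau$ with $\tau\in M$. A vertex $v$ of $K$ is dominated if $\mathrm{lk}_K(v)$ is a simplicial cone; in that case there is an elementary strong collapse from $K$ to $K\smallsetminus v$. A strong collapse from $K$ to a subcomplex $L$ is a finite (possibly empty) sequence of elementary strong collapses starting in $K$ and ending in $L$; its inverse is a strong expansion. Two complexes have the same strong homotopy type if there is a sequence of strong collapses and strong expansions that starts in one and ends in the other. A complex is minimal if it has no dominated vertices. A core of $K$ is a subcomplex $K_0\subseteq K$ which is a minimal complex and such that there is a strong collapse from $K$ to $K_0$. *)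

(* Defs.v *)
From HB Require Import structures.
From Stdlib Require Export Relation_Operators.
From mathcomp Require Export all_boot finmap.

Set Implicit Arguments.
Unset Strict Implicit.
Unset Printing Implicit Defensive.

Local Open Scope fset_scope.

Section Complexes.
Variable V : choiceType.
Implicit Types (v a : V) (s t W : {fset V}) (S : {fset {fset V}}).

Definition is_complex S : bool :=
  (fset0 \notin S) &&
  all (fun s => all (fun t => (t != fset0) ==> (t \in S)) (fpowerset s)) S.

Lemma is_complexP S :
  reflect (fset0 \notin S /\
           (forall s t, s \in S -> t `<=` s -> t != fset0 -> t \in S))
          (is_complex S).
Proof.
apply: (iffP andP) => -[S0 cS]; split=> //.
  move=> s t sS ts t0; move/allP: cS => /(_ s sS) /allP /(_ t).
  by rewrite fpowersetE t0 => /(_ ts).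
apply/allP => s sS; apply/allP => t; rewrite fpowersetE => ts.
by apply/implyP; apply: cS sS ts.
Qed.

(* A complex is given by its simplices, so its vertices are exactly the points *)
(* lying in some simplex.  The empty complex is allowed.                       *)
Record complex := Complex { simplices :> {fset {fset V}}; _ : is_complex simplices }.

HB.instance Definition _ := [isSub for simplices].
HB.instance Definition _ := [Equality of complex by <:].

Implicit Types K L M : complex.

Lemma simplex_neq0 K s : s \in simplices K -> s != fset0.
Proof.
case: K => S /= /is_complexP[S0 _] sS.
by apply: contraNneq S0 => <-.
Qed.

Lemma simplex_sub K s t :
  s \in simplices K -> t `<=` s -> t != fset0 -> t \in simplices K.
Proof. by case: K => S /= /is_complexP[_]; apply. Qed.

Definition vertices K : {fset V} := \bigcup_(s <- simplices K) s.

Definition subcomplex L K : Prop := simplices L `<=` simplices K.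

Definition full_simplices K W : {fset {fset V}} :=
  [fset t in simplices K | t `<=` W].

Lemma full_is_complex K W : is_complex (full_simplices K W).
Proof.
apply/is_complexP; split=> [|s t].
  by rewrite !inE; apply/negP=> /andP[/simplex_neq0]; rewrite eqxx.
rewrite !inE => /andP[sK sW] ts t0.
by rewrite (simplex_sub sK ts t0) (fsubset_trans ts sW).
Qed.

Definition full_subcomplex K W : complex := Complex (full_is_complex K W).

Definition deletion K v : complex := full_subcomplex K (vertices K `\ v).

Definition link_simplices K v : {fset {fset V}} :=
  [fset t in simplices K | (v \notin t) && (v |` t \in simplices K)].

Lemma link_is_complex K v : is_complex (link_simplices K v).
Proof.
apply/is_complexP; split=> [|s t].
  by rewrite !inE; apply/negP=> /andP[/simplex_neq0]; rewrite eqxx.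
rewrite !inE => /and3P[sK vs vsK] ts t0.
rewrite (simplex_sub sK ts t0) (contraNN ((fsubsetP ts) v) vs) /=.
apply: (simplex_sub vsK); first exact: fsetUS.
by apply/fset0Pn; exists v; rewrite !inE eqxx.
Qed.

Definition link K v : complex := Complex (link_is_complex K v).

Definition cone_simplices a M : {fset {fset V}} :=
  [fset [fset a]] `|` simplices M `|` [fset a |` t | t in simplices M].

Lemma cone_is_complex a M : is_complex (cone_simplices a M).
Proof.
have U s : (s \in cone_simplices a M) =
    [|| s == [fset a], s \in simplices M
      | s \in [fset a |` t | t in simplices M]].
  by rewrite !in_fsetU in_fset1 orbA.
apply/is_complexP; split=> [|s t].
  rewrite U; apply/negP => /or3P[/eqP/fsetP/(_ a)|/simplex_neq0|/imfsetP[t _ /fsetP/(_ a)]].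
  - by rewrite !inE eqxx.
  - by rewrite eqxx.
  - by rewrite !inE eqxx.
have key r : t `<=` a |` r -> (r == fset0) || (r \in simplices M) ->
    t != fset0 -> t \in cone_simplices a M.
  move=> tr rM t0; rewrite U.
  have tar : t `\ a `<=` r by rewrite fsubDset.
  have [ta0|ta0] := eqVneq (t `\ a) fset0.
    have : t `<=` [fset a] by rewrite -fsetD_eq0 ta0.
    by rewrite fsubset1 (negPf t0) orbF => ->.
  have rM' : r \in simplices M.
    case/orP: rM => // /eqP r0; move: tar; rewrite r0 fsubset0.
    by rewrite (negPf ta0).
  have taM := simplex_sub rM' tar ta0.
  have [at_|at_] := boolP (a \in t).
    apply/or3P; apply: Or33; apply/imfsetP; exists (t `\ a) => //=.
    by rewrite fsetD1K.
  apply/or3P; apply: Or32.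
  suff <- : t `\ a = t by [].
  by apply/fsetP => x; rewrite !inE; case: eqP => // ->; rewrite (negPf at_).
rewrite U => /or3P[/eqP-> ts|sM ts|/imfsetP[r /= rM ->] ts].
- by apply: (key fset0); rewrite ?fsetU0 ?eqxx.
- apply: (key s); last by rewrite sM orbT.
  exact: fsubset_trans ts (fsubsetUr _ _).
- by apply: (key r) => //; rewrite rM orbT.
Qed.

Definition cone a M : complex := Complex (cone_is_complex a M).

Definition is_simplicial_cone L : Prop :=
  exists a M, a \notin vertices M /\ L = cone a M.

Definition dominated K v : Prop :=
  v \in vertices K /\ is_simplicial_cone (link K v).

Definition elementary_strong_collapse K L : Prop :=
  exists v, dominated K v /\ L = deletion K v.

Definition strong_collapse : complex -> complex -> Prop :=
  clos_refl_trans complex elementary_strong_collapse.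

Definition strong_expansion K L : Prop := strong_collapse L K.

Definition same_strong_homotopy_type : complex -> complex -> Prop :=
  clos_refl_trans complex
    (fun K L => strong_collapse K L \/ strong_expansion K L).

Definition minimal K : Prop := ~ exists v, dominated K v.

Definition is_core K0 K : Prop :=
  [/\ subcomplex K0 K, minimal K0 & strong_collapse K K0].

Definition simplicial_map K L (f : V -> V) : Prop :=
  forall s, s \in simplices K -> f @` s \in simplices L.

(* Only the values of f on vertices of K and of g on vertices of L matter. *)
Definition isomorphic K L : Prop :=
  exists f g : V -> V,
    [/\ simplicial_map K L f, simplicial_map L K g,
        {in vertices K, cancel f g} & {in vertices L, cancel g f}].

End Complexes.

(* Strong expansions keep the old vertices and add new ones, taken from the    *)
(* ambient type V, so an unlimited supply of them must be available there.     *)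
Definition infinite_type (V : choiceType) : Prop :=
  forall W : {fset V}, exists v, v \notin W.

(* Main.v *)
From Stdlib Require Import Classical Operators_Properties.
Require Import Defs.

Set Implicit Arguments.
Unset Strict Implicit.
Unset Printing Implicit Defensive.

(** Call two simplicial maps contiguous when the union of the images of each
    simplex is a simplex.  A vertex [v] is dominated exactly when some [a != v]
    can be added to every simplex containing [v]; sending [v] to [a] is then
    contiguous to the identity, so a strong collapse is an equivalence up to
    contiguity classes.  In a minimal complex a map contiguous to the identity
    is the identity, because [f v != v] would dominate [v]; hence equivalent
    minimal complexes are isomorphic.
    Conversely, inflating the vertices of a complex [L] along a map [p] onto them
    gives a complex that strongly collapses to the part spanned by any set that
    [p] still maps onto the vertices of [L].
    Two isomorphic complexes are related in this way through a common inflation on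
    fresh vertices. *)

Local Open Scope fset_scope.

Section StrongHomotopy.
Variable V : choiceType.
Implicit Types (a v w x : V) (s t W : {fset V}) (f g h k p : V -> V).
Implicit Types K L M : complex V.

(** * Simplices, links and dominated vertices *)

Lemma complex_eq K L : simplices K =i simplices L -> K = L.
Proof. by move=> KL; apply/val_inj/fsetP. Qed.

Lemma vertexE K v : (v \in vertices K) = ([fset v] \in simplices K).
Proof.
apply/bigfcupP/idP => [[s /andP[sK _] vs]|vK].
  by apply: (simplex_sub sK); [rewrite fsub1set | apply/fset0Pn; exists v; rewrite inE].
by exists [fset v]; rewrite ?vK ?inE.
Qed.

Lemma simplex_vertices K s : s \in simplices K -> s `<=` vertices K.
Proof. by move=> sK; apply/fsubsetP=> x xs; apply/bigfcupP; exists s; rewrite ?sK. Qed.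

Lemma fsetU1_neq0 v s : v |` s != fset0.
Proof. by apply/fset0Pn; exists v; rewrite !inE eqxx. Qed.

Lemma in_full K W s : (s \in simplices (full_subcomplex K W)) =
  (s \in simplices K) && (s `<=` W).
Proof. by rewrite !inE. Qed.

Lemma in_deletion K v s :
  (s \in simplices (deletion K v)) = (s \in simplices K) && (v \notin s).
Proof.
rewrite in_full fsubsetD1; case: (boolP (s \in _)) => //= sK.
by rewrite simplex_vertices.
Qed.

Lemma in_link K v s :
  (s \in simplices (link K v)) =
  [&& s \in simplices K, v \notin s & v |` s \in simplices K].
Proof. by rewrite !inE. Qed.

Lemma in_cone a M s : (s \in simplices (cone a M)) =
  [|| s == [fset a], s \in simplices M
    | s \in [fset a |` t | t in simplices M]].
Proof. by rewrite !in_fsetU in_fset1 orbA. Qed.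

Lemma cone_apexU a M s : s \in simplices (cone a M) ->
  a |` s \in simplices (cone a M).
Proof.
rewrite !in_cone => /or3P[/eqP->|sM|/imfsetP[t /= tM ->]].
- by rewrite fsetUid eqxx.
- by apply/or3P/Or33/imfsetP; exists s.
- by apply/or3P/Or33/imfsetP; exists t; rewrite // fsetUA fsetUid.
Qed.

(** An apex of the link serves as [a]; conversely, such an [a] makes the link the cone from [a] over
    its own deletion of [a]. *)
Lemma dominatedP K v : dominated K v <->
  v \in vertices K /\
  exists2 a, a != v &
    forall s, s \in simplices K -> v \in s -> a |` s \in simplices K.
Proof.
split=> -[vK]; last first.
  move=> [a av aP]; split=> //; exists a, (deletion (link K v) a).
  have vaK : v |` [fset a] \in simplices K.
    by rewrite fsetUC; apply: aP; rewrite ?inE -?vertexE.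
  have aK : [fset a] \in simplices K.
    by apply: (simplex_sub vaK (fsubsetUr _ _)); rewrite -(fsetU0 [fset a]) fsetU1_neq0.
  have va : v \notin [fset a] by rewrite inE eq_sym.
  split; first by rewrite vertexE in_deletion inE eqxx andbF.
  apply: complex_eq => s; rewrite in_cone in_deletion.
  apply/idP/or3P=> [sL|].
    have [as_|as_] := boolP (a \in s); last by apply: Or32; rewrite sL.
    have [sa0|sa0] := eqVneq (s `\ a) fset0.
      apply: Or31; rewrite -(fsetD1K as_) sa0 fsetU0 //.
    apply: Or33; apply/imfsetP; exists (s `\ a); rewrite /= ?fsetD1K //.
    rewrite in_deletion fsetD11 andbT.
    exact: (simplex_sub sL (fsubD1set _ _) sa0).
  case=> [/eqP->|/andP[]//|/imfsetP[t /=]]; first by rewrite in_link aK va.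
  rewrite in_deletion in_link => /andP[/and3P[tK vt vtK] at_ ->].
  have avtK : v |` (a |` t) \in simplices K.
    by rewrite fsetUCA; apply: aP; rewrite ?inE ?eqxx.
  rewrite in_link avtK !inE negb_or vt eq_sym av !andbT.
  exact: (simplex_sub avtK (fsubsetUr _ _) (fsetU1_neq0 _ _)).
move=> [a [M [_ lkE]]]; split=> //.
have : [fset a] \in simplices (link K v) by rewrite lkE in_cone eqxx.
rewrite in_link inE eq_sym => /and3P[aK av vaK].
exists a => // s sK vs.
(* The case of [s] reduced to [v] is separate because the empty set is not a simplex of the link. *)
have [sv0|sv0] := eqVneq (s `\ v) fset0.
  by rewrite -(fsetD1K vs) sv0 fsetU0 fsetUC.
have : s `\ v \in simplices (link K v).
  by rewrite in_link (simplex_sub sK (fsubD1set _ _) sv0) fsetD1K // sK !inE eqxx.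
rewrite lkE => /cone_apexU; rewrite -lkE in_link => /and3P[_ _].
by rewrite fsetUCA fsetD1K.
Qed.

(** * Existence of cores *)

Lemma elementary_sub K L : elementary_strong_collapse K L ->
  simplices L `<` simplices K.
Proof.
move=> [v [[vK _] ->]]; rewrite fproperE fset_sub.
apply/fsubsetPn; exists [fset v]; first by rewrite -vertexE.
by rewrite in_deletion inE eqxx andbF.
Qed.

Lemma collapse_sub K L : strong_collapse K L -> subcomplex L K.
Proof.
elim=> [x y /elementary_sub/fproper_sub //|x|x y z _ xy _ yz].
  exact: fsubset_refl.
exact: fsubset_trans yz xy.
Qed.

Lemma core_exists K : exists K0, is_core K0 K.
Proof.
suff [K0 minK0 KK0] : exists2 K0, minimal K0 & strong_collapse K K0.
  by exists K0; split=> //; apply: collapse_sub.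
(* Each elementary collapse loses at least one simplex, so deleting dominated vertices as long as
   there are any must stop. *)
have [n] := ubnP #|` simplices K|; elim: n K => // n IH K ltn.
have [[v vK]|?] := classic (exists v, dominated K v); last first.
  by exists K => //; apply: rt_refl.
have KD : elementary_strong_collapse K (deletion K v) by exists v.
have [K0 minK0 DK0] : exists2 K0, minimal K0 & strong_collapse (deletion K v) K0.
  by apply/IH/(leq_trans (fproper_ltn_card (elementary_sub KD))).
by exists K0 => //; apply: rt_trans DK0; apply: rt_step.
Qed.

(** * Contiguity classes and strong equivalence *)

Definition contiguous K L f g : Prop :=
  forall s, s \in simplices K -> (f @` s) `|` (g @` s) \in simplices L.

(** Contiguity is symmetric, so this closure is already an equivalence relation; its classes are the
    contiguity classes. *)
Definition homotopic K L : (V -> V) -> (V -> V) -> Prop :=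
  clos_refl_trans (V -> V) (contiguous K L).

Lemma homotopic_comp_left K L M f f' g : simplicial_map L M g ->
  homotopic K L f f' -> homotopic K M (g \o f) (g \o f').
Proof.
move=> gS; elim=> [x y xy|x|x y z _ xy _ yz].
- by apply: rt_step => s sK; rewrite (imfset_comp _ x g) (imfset_comp _ y g) -imfsetU; apply/gS/xy.
- exact: rt_refl.
- exact: rt_trans yz.
Qed.

Lemma homotopic_comp_right K L M f g g' : simplicial_map K L f ->
  homotopic L M g g' -> homotopic K M (g \o f) (g' \o f).
Proof.
move=> fS; elim=> [x y xy|x|x y z _ xy _ yz].
- by apply: rt_step => s sK; rewrite (imfset_comp _ f x) (imfset_comp _ f y); apply/xy/fS.
- exact: rt_refl.
- exact: rt_trans yz.
Qed.

Definition strong_equivalent K L : Prop :=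
  exists f g, [/\ simplicial_map K L f, simplicial_map L K g,
    homotopic K K (g \o f) id & homotopic L L (f \o g) id].

Lemma strong_equivalent_refl K : strong_equivalent K K.
Proof.
by exists id, id; split=> [s|s||]; rewrite ?imfset_id //; apply: rt_refl.
Qed.

Lemma strong_equivalent_sym K L : strong_equivalent K L -> strong_equivalent L K.
Proof. by move=> [f [g []]]; exists g, f. Qed.

Lemma strong_equivalent_trans K L M :
  strong_equivalent K L -> strong_equivalent L M -> strong_equivalent K M.
Proof.
move=> [f [g [fS gS gf fg]]] [h [k [hS kS kh hk]]].
exists (h \o f), (g \o k); split=> [s sK|s sM||].
- by rewrite imfset_comp; apply/hS/fS.
- by rewrite imfset_comp; apply/gS/kS.
- apply: rt_trans gf.
  exact: (homotopic_comp_left gS (homotopic_comp_right fS kh)).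
- apply: rt_trans hk.
  exact: (homotopic_comp_left hS (homotopic_comp_right kS fg)).
Qed.

Lemma elementary_strong_equivalent K L :
  elementary_strong_collapse K L -> strong_equivalent K L.
Proof.
move=> [v [/dominatedP[vK [a av aP]] ->]].
(* The inverse pair will be [r] and the inclusion, written [id]. Both composites are [r], which is
   contiguous to the identity on [K] and fixes every simplex avoiding [v]. *)
pose r x := if x == v then a else x.
have r_id s : v \notin s -> r @` s = s.
  move=> vs; rewrite -[RHS]imfset_id; apply: eq_in_imfset => x xs.
  by rewrite /r; case: eqP => // xv; rewrite -xv xs in vs.
have rU s : s \in simplices K -> r @` s `|` s \in simplices K.
  move=> sK; have [vs|/r_id->] := boolP (v \in s); last by rewrite fsetUid.
  (* Both [s] and its image under [r] lie in [s] with [a] added, a simplex by domination. *)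
  apply: (simplex_sub (aP _ sK vs)).
    rewrite fsubUset fsubsetUr andbT; apply/fsubsetP=> _ /imfsetP[x /= xs ->].
    by rewrite /r !inE; case: ifP; rewrite ?eqxx ?xs ?orbT.
  by apply/fset0Pn; exists v; rewrite inE vs orbT.
have v_r s : v \notin r @` s.
  apply/imfsetP=> -[x _] /=; rewrite /r; case: eqP => [_ /eqP|xv /esym //].
  by rewrite eq_sym (negPf av).
exists r, id; split=> [s sK|s||].
- rewrite in_deletion v_r andbT; apply: (simplex_sub (rU _ sK) (fsubsetUl _ _)).
  have /fset0Pn[x xs] := simplex_neq0 sK.
  by apply/fset0Pn; exists (r x); apply: in_imfset.
- by rewrite imfset_id in_deletion => /andP[].
- by apply: rt_step => s sK; rewrite imfset_id; apply: rU.
- apply: rt_step => s; rewrite imfset_id in_deletion => /andP[sK vs].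
  by rewrite (r_id s vs) fsetUid in_deletion sK.
Qed.

Lemma collapse_strong_equivalent K L :
  strong_collapse K L -> strong_equivalent K L.
Proof.
elim=> [x y|x|x y z _ xy _ yz].
- exact: elementary_strong_equivalent.
- exact: strong_equivalent_refl.
- exact: strong_equivalent_trans xy yz.
Qed.

Lemma same_type_strong_equivalent K L :
  same_strong_homotopy_type K L -> strong_equivalent K L.
Proof.
elim=> [x y [xy|yx]|x|x y z _ xy _ yz].
- exact: collapse_strong_equivalent.
- exact/strong_equivalent_sym/collapse_strong_equivalent.
- exact: strong_equivalent_refl.
- exact: strong_equivalent_trans xy yz.
Qed.

(** * Rigidity of minimal complexes *)

Lemma contiguous_id_minimal K f : minimal K -> contiguous K K f id ->
  {in vertices K, f =1 id}.
Proof.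
move=> minK fid v vK; apply/eqP/negPn/negP => fv.
apply: minK; exists v; apply/dominatedP; split=> //; exists (f v) => // s sK vs.
apply: (simplex_sub (fid s sK)); last exact: fsetU1_neq0.
by rewrite imfset_id fsubUset fsubsetUr fsub1set inE in_imfset.
Qed.

Lemma homotopic_id_minimal K f : minimal K -> homotopic K K f id ->
  {in vertices K, f =1 id}.
Proof.
move=> minK f_id.
(* The chain is read backwards from its end. The end [g] is only asked to agree with [id] on the
   vertices, because that is all each step passes on to the preceding map. *)
suff chain g : clos_refl_trans_1n _ (contiguous K K) f g ->
    {in vertices K, g =1 id} -> {in vertices K, f =1 id}.
  by apply: (chain id) => //; apply: clos_rt_rt1n.
elim=> // x y z xy _ IH /IH{}IH; apply: contiguous_id_minimal => // s sK.
have -> : id @` s = y @` s.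
  apply: eq_in_imfset => v vs; rewrite IH //.
  exact: (fsubsetP (simplex_vertices sK)).
exact: xy.
Qed.

Lemma minimal_equivalent_isomorphic K L : minimal K -> minimal L ->
  strong_equivalent K L -> isomorphic K L.
Proof.
move=> minK minL [f [g [fS gS gf fg]]]; exists f, g; split=> //.
  exact: homotopic_id_minimal gf.
exact: homotopic_id_minimal fg.
Qed.

(** Taking [K = L] gives uniqueness of the core; in general it shows that the strong homotopy type
    determines the core. *)
Lemma cores_isomorphic K L K0 L0 : is_core K0 K -> is_core L0 L ->
  strong_equivalent K L -> isomorphic K0 L0.
Proof.
move=> [_ minK0 KK0] [_ minL0 LL0] KL; apply: minimal_equivalent_isomorphic => //.
apply: strong_equivalent_trans (collapse_strong_equivalent LL0).
apply: strong_equivalent_trans KL.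
exact/strong_equivalent_sym/collapse_strong_equivalent.
Qed.

(** * Inflations and their collapses *)

Definition inflation_simplices W p L : {fset {fset V}} :=
  [fset s in fpowerset W | p @` s \in simplices L].

Lemma inflation_is_complex W p L : is_complex (inflation_simplices W p L).
Proof.
apply/is_complexP; split=> [|s t].
  by rewrite !inE imfset0; apply/negP=> /andP[_ /simplex_neq0]; rewrite eqxx.
rewrite !inE !fpowersetE => /andP[sW sL] ts t0.
rewrite (fsubset_trans ts sW) /=; apply: (simplex_sub sL).
  by apply: subset_imfset => x /(fsubsetP ts).
by case/fset0Pn: t0 => x xt; apply/fset0Pn; exists (p x); apply: in_imfset.
Qed.

(** Each vertex of [L] is replaced by its fibre under [p] in [W]; points of one fibre are
    interchangeable in the simplices. *)
Definition inflation W p L : complex V := Complex (inflation_is_complex W p L).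

Lemma in_inflation W p L s : (s \in simplices (inflation W p L)) =
  (s `<=` W) && (p @` s \in simplices L).
Proof. by rewrite !inE fpowersetE. Qed.

(** A point [v] outside [W'] has a twin in [W'] with the same image. Adding the twin to a simplex
    containing [v] leaves the image unchanged, so the twin dominates [v]; such points are deleted
    one by one. *)
Lemma inflation_collapse W W' p L : W' `<=` W ->
  (forall w, w \in W -> p w \in vertices L /\ exists2 w', w' \in W' & p w' = p w) ->
  strong_collapse (inflation W p L) (inflation W' p L).
Proof.
have [n] := ubnP #|` W|; elim: n W => // n IH W ltn W'W pW.
have [<-|] := eqVneq W' W; first exact: rt_refl.
rewrite eqEfsubset W'W => /fsubsetPn[v vW vW'].
apply: (@rt_trans _ _ _ (inflation (W `\ v) p L)); last first.
  apply: IH => [||w]; last by rewrite inE => /andP[_ /pW].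
    by move: ltn; rewrite (cardfsD1 v W) vW.
  by rewrite fsubsetD1 W'W.
apply: rt_step; exists v; split; last first.
  apply: complex_eq => s; rewrite in_deletion !in_inflation fsubsetD1.
  by rewrite andbAC.
have [pvL [w wW' pwv]] := pW v vW.
apply/dominatedP; split.
  by rewrite vertexE in_inflation fsub1set vW imfset_fset1 -vertexE.
exists w; first by apply: contraNneq vW' => <-.
move=> s; rewrite !in_inflation => /andP[sW psL] vs.
rewrite fsubUset fsub1set (fsubsetP W'W) // sW imfsetU1 pwv.
by rewrite (fsetUidPr _ _ _) // fsub1set in_imfset.
Qed.

Lemma inflation_vertices p L : {in vertices L, p =1 id} ->
  inflation (vertices L) p L = L.
Proof.
move=> p_id; apply: complex_eq => s; rewrite in_inflation.
have pE : s `<=` vertices L -> p @` s = s.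
  move=> /fsubsetP sL; rewrite -[RHS]imfset_id; apply: eq_in_imfset => x xs.
  exact/p_id/sL.
apply/andP/idP => [[/pE->]//|sL].
by have sV := simplex_vertices sL; rewrite pE.
Qed.

(** Both complexes are collapses of one larger inflation, on the union of [W] and the vertices of
    [L]. Disjointness lets [p] on [W] and the identity on the vertices be glued into a single map
    [q]. *)
Lemma inflation_same_type W p L : [disjoint W & vertices L] ->
  p @` W = vertices L ->
  same_strong_homotopy_type (inflation W p L) L.
Proof.
move=> dis pW; pose q x := if x \in W then p x else x.
have qW : {in W, q =1 p} by move=> x xW; rewrite /q xW.
have qL : {in vertices L, q =1 id}.
  by move=> x xL; rewrite /q; case: ifP => // /(fdisjointP dis); rewrite xL.
have -> : inflation W p L = inflation W q L.
  apply: complex_eq => s; rewrite !in_inflation; case: (boolP (s `<=` W)) => // sW.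
  suff -> : p @` s = q @` s by []; apply: eq_in_imfset => x xs; rewrite qW //.
  exact: (fsubsetP sW).
have qVL w : w \in W -> q w \in vertices L.
  by move=> wW; rewrite qW // -pW in_imfset.
rewrite -{2}(inflation_vertices qL).
apply: (@rt_trans _ _ _ (inflation (W `|` vertices L) q L)).
  apply: rt_step; right; apply: inflation_collapse => [|w]; first exact: fsubsetUl.
  rewrite inE => /orP[wW|wL]; first by split; [exact: qVL | exists w].
  rewrite qL //; split=> //; move: wL; rewrite -{1}pW => /imfsetP[w' /= w'W ->].
  by exists w'; rewrite ?qW.
apply: rt_step; left; apply: inflation_collapse => [|w]; first exact: fsubsetUr.
rewrite inE => wWL; have qwL : q w \in vertices L.
  by case/orP: wWL => [/qVL//|wL]; rewrite qL.
by split=> //; exists (q w); rewrite ?(qL _ qwL).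
Qed.

(** * From isomorphism to strong homotopy type *)

Lemma fresh_cover A B : infinite_type V ->
  exists W p, [disjoint W & B] /\ p @` W = A.
Proof.
move=> infV; elim/fset1U_rect: A => [|a A aA [W [p [dis pW]]]].
  by exists fset0, id; split; [apply/fdisjointP => x; rewrite inE | rewrite imfset0].
have [w] := infV (W `|` B); rewrite inE negb_or => /andP[wW wB].
(* The fresh point [w] becomes a preimage of [a]; being outside [W], it leaves the earlier values
   intact. *)
pose q x := if x == w then a else p x.
have qW : {in W, q =1 p}.
  by move=> x xW; rewrite /q; case: eqP => // xw; rewrite -xw xW in wW.
exists (w |` W), q; split; first by rewrite fdisjointU1X wB.
have qWA : q @` W = A by rewrite -pW; apply: eq_in_imfset.
by rewrite imfsetU1 qWA /q eqxx.
Qed.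

(** The vertices of [K] and [L] may overlap in incompatible ways, so the comparison passes through a
    set [W] disjoint from both, mapped onto one by [p] and onto the other by [f \o p]. *)
Lemma isomorphic_same_type K L : infinite_type V -> isomorphic K L ->
  same_strong_homotopy_type K L.
Proof.
move=> infV [f [g [fS gS fK gK]]].
have [W [p [dis pW]]] := fresh_cover (vertices K) (vertices K `|` vertices L) infV.
move: dis; rewrite fdisjointXU => /andP[disK disL].
have st_sym M N : same_strong_homotopy_type M N -> same_strong_homotopy_type N M.
  elim=> [x y xy|x|x y z _ xy _ yz]; last exact: rt_trans yz xy.
    by apply: rt_step; case: xy; [right | left].
  exact: rt_refl.
have fV x : x \in vertices K -> f x \in vertices L.
  by rewrite !vertexE => /fS; rewrite imfset_fset1.
have gV x : x \in vertices L -> g x \in vertices K.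
  by rewrite !vertexE => /gS; rewrite imfset_fset1.
have fpW : (f \o p) @` W = vertices L.
  rewrite imfset_comp pW; apply/fsetP=> x; apply/imfsetP/idP => [[y /= yK ->]|xL].
    exact: fV.
  by exists (g x); rewrite ?gK //=; apply: gV.
apply: (rt_trans _ _ _ (inflation W p K)).
  exact/st_sym/inflation_same_type.
(* The two conditions on [s] agree: [f] carries simplices of [K] to [L], and [g] carries them back
   since it undoes [f] on vertices. *)
have -> : inflation W p K = inflation W (f \o p) L.
  apply: complex_eq => s; rewrite !in_inflation; case: (boolP (s `<=` W)) => // sW.
  rewrite (imfset_comp _ p f).
  suff gfK : g @` (f @` (p @` s)) = p @` s.
    by apply/idP/idP => [/fS//|/gS]; rewrite gfK.
  rewrite -(imfset_comp _ f g) -[RHS]imfset_id.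
  apply: eq_in_imfset => x /imfsetP[y /= ys ->].
  by apply: fK; rewrite -pW in_imfset //= (fsubsetP sW).
exact: inflation_same_type.
Qed.

End StrongHomotopy.

Theorem theorem2p11 (V : choiceType) :
  (forall K : complex V,
     (exists K0 : complex V, is_core K0 K) /\
     (forall K1 K2 : complex V, is_core K1 K -> is_core K2 K -> isomorphic K1 K2)) /\
  (infinite_type V ->
   forall K L K0 L0 : complex V, is_core K0 K -> is_core L0 L ->
     (same_strong_homotopy_type K L <-> isomorphic K0 L0)).
Proof.
split=> [K|infV K L K0 L0 K0K L0L].
  split=> [|K1 K2 K1K K2K]; first exact: core_exists.
  exact: (cores_isomorphic K1K K2K (strong_equivalent_refl K)).
split=> [/same_type_strong_equivalent|iso]; first exact: cores_isomorphic.
case: K0K L0L => _ _ KK0 [_ _ LL0].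
(* Collapse [K] to its core, pass to the isomorphic core [L0], then expand to [L]. *)
apply: (rt_trans _ _ _ K0); first by apply: rt_step; left.
apply: (rt_trans _ _ _ L0); last by apply: rt_step; right.
exact: isomorphic_same_type.
Qed.
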